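(* Let $(p^i_n)_{n\ge1}$, $i=1,\dots,m$, be always valid p-value processes for the hypotheses $H_0^i:\theta^i=\theta^i_0$ (with arbitrary dependence across $i$), let $\alpha\in(0,1)$, and let $T$ be an arbitrary stopping time. Then the set of decisions obtained by applying the BH-G procedure at level $\alpha$ to $\mathbf p_T=(p^1_T,\dots,p^m_T)$ controls the false discovery rate at level $\alpha$: for every $\boldsymbol\theta=(\theta^1,\dots,\theta^m)$, $$\mathbb E_{\boldsymbol\theta}\left[\frac{\#\{i:\theta^i=\theta^i_0,\ i\text{ rejected}\}}{\max(\#\{i: i\text{ rejected}\},1)}\right]\le\alpha.$$
   Context: $m$ experiments are run simultaneously; at each step one observation is made on every experiment. Stopping times are with respect to the filtration generated by all the data and may be infinite. $(p^i_n)_n$ is an always valid p-value process for $H^i_0$ if it is $[0,1]$-valued, adapted and, whenever $\theta^i=\theta^i_0$, $\mathbb P_{\boldsymbol\theta}(T<\infty,\ p^i_T\le s)\le s$ for every stopping time $T$ and $s\in[0,1]$. The BH-G procedure at level $\alpha$: order the p-values $p^{(1)}\le\dots\le p^{(m)}$ and reject hypotheses $(1),\dots,(j)$, where $j$ is maximal such that $$p^{(j)}\le\frac{\alpha j}{m\sum_{r=1}^m1/r}$$ (none if no such $j$). Nothing is rejected if $T=\infty$. *)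

(* Defs.v *)
From HB Require Import structures.
From mathcomp Require Import all_boot all_order all_algebra.
From mathcomp Require Import all_classical all_reals all_analysis.

Set Implicit Arguments.
Unset Strict Implicit.
Unset Printing Implicit Defensive.

Import Order.TTheory GRing.Theory Num.Theory.

Local Open Scope classical_set_scope.
Local Open Scope ring_scope.

(* Steps are numbered from 0: index n : nat stands for
   step n + 1.  A possibly infinite random time is a map to option nat, with
   None for infinity. *)

Definition data_filtration (m : nat) (d dE : measure_display)
    (Omega : measurableType d) (E : 'I_m -> measurableType dE)
    (X : forall i : 'I_m, nat -> {mfun Omega >-> E i}) (n : nat) :
    set_system Omega :=
  <<s \bigcup_(i in [set: 'I_m]) \bigcup_(k < n.+1)
        preimage_set_system [set: Omega] (X i k) measurable >>.

Definition stopping_time (Omega : Type) (F : nat -> set_system Omega)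
    (T : Omega -> option nat) : Prop :=
  forall n : nat, F n [set w | exists2 k : nat, T w = Some k & (k <= n)%N].

Definition adapted (d : measure_display) (Omega : Type)
    (V : measurableType d) (F : nat -> set_system Omega)
    (Y : nat -> Omega -> V) : Prop :=
  forall n : nat, preimage_set_system [set: Omega] (Y n) measurable `<=` F n.

Definition always_valid (R : realType) (d : measure_display)
    (Omega : measurableType d) (Params : Type)
    (P : Params -> probability Omega R) (F : nat -> set_system Omega)
    (H0 : set Params) (p : nat -> Omega -> R) : Prop :=
  [/\ forall n w, 0 <= p n w <= 1,
      adapted F p
    & forall theta, H0 theta ->
      forall T : Omega -> option nat, stopping_time F T ->
      forall s : R, 0 <= s <= 1 ->
      (P theta [set w | exists2 n, T w = Some n & (p n w <= s)%R]
        <= s%:E)%E].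

(* The hypotheses by increasing p-value; ties are broken by the sort. *)
Definition pvalue_order (R : realType) (m : nat) (p : 'I_m -> R) :
    seq 'I_m :=
  sort (fun i k : 'I_m => p i <= p k) (enum 'I_m).

(* Entry j (from 0) is the order statistic p^(j + 1). *)
Definition ordered_pvalues (R : realType) (m : nat) (p : 'I_m -> R) : seq R :=
  [seq p i | i <- pvalue_order p].

Definition bhg_threshold (R : realType) (m : nat) (alpha : R) (j : nat) : R :=
  alpha * j%:R / (m%:R * \sum_(1 <= r < m.+1) r%:R^-1).

(* The maximum of the empty set being 0, nothing is rejected when no p-value
   is below its threshold. *)
Definition bhg_count (R : realType) (m : nat) (alpha : R) (p : 'I_m -> R) :
    nat :=
  (\max_(j < m | ((ordered_pvalues p)`_j <= bhg_threshold m alpha j.+1)%R)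
     j.+1)%N.

Definition bhg_rejected (R : realType) (m : nat) (alpha : R)
    (p : 'I_m -> R) : {set 'I_m} :=
  [set:: take (bhg_count alpha p) (pvalue_order p)]%SET.

Definition bhg_rejected_at (R : realType) (m : nat) (Omega : Type)
    (alpha : R) (p : 'I_m -> nat -> Omega -> R) (T : Omega -> option nat)
    (w : Omega) : {set 'I_m} :=
  if T w is Some n then bhg_rejected alpha (fun i => p i n w) else finset.set0.

Definition true_nulls (m : nat) (Theta : 'I_m -> Type)
    (theta0 theta : forall i : 'I_m, Theta i) : {set 'I_m} :=
  [set i | `[< theta i = theta0 i >]]%SET.

Definition false_discovery_proportion (R : realType) (m : nat)
    (nulls rejected : {set 'I_m}) : R :=
  #|(nulls :&: rejected)%SET|%:R / (maxn #|rejected| 1)%:R.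

(* Main.v *)
(** If hypothesis [i] is rejected along with [k - 1] others, then its p-value is
    at most the threshold [t k = alpha k / (m H_m)], where [H_m] is the [m]-th
    harmonic number.  Its contribution [1 / k] to the false discovery proportion
    telescopes as the sum over [k <= j <= m] of [1 / j - 1 / (j + 1)] (with
    [1 / m] in place of the last term), and [p_i <= t k <= t j] for those [j];
    so the contribution is at most the weighted sum over all [j <= m] of the
    indicators of [p_i <= t j], whatever the other p-values are.  For a true
    null, always-validity at [T] bounds the probability of each of these events
    by [t j], and Abel summation turns the weighted sum of the [t j] into
    [alpha / (m H_m) * H_m = alpha / m]. *)
Require Import Defs.
From HB Require Import structures.
From mathcomp Require Import all_boot all_order all_algebra.
From mathcomp Require Import all_classical all_reals all_analysis.
From mathcomp Require Import measurable_realfun ring.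

Set Implicit Arguments.
Unset Strict Implicit.
Unset Printing Implicit Defensive.

Import Order.TTheory GRing.Theory Num.Theory.

Local Open Scope classical_set_scope.
Local Open Scope ring_scope.

(* Unlike [ge0_le_integral], needs no measurability, which spares proving that
   the false discovery proportion is measurable. *)
Lemma ge0_le_integralT (R : realType) (d : measure_display)
    (T : measurableType d) (mu : {measure set T -> \bar R})
    (f g : T -> \bar R) :
  (forall x, 0 <= f x)%E -> (forall x, f x <= g x)%E ->
  (\int[mu]_x f x <= \int[mu]_x g x)%E.
Proof.
move=> f0 fg; rewrite !ge0_integralE//; last first.
  by move=> x _; exact: le_trans (f0 x) (fg x).
apply: le_ereal_sup => _ [h /= hf <-]; exists h => //= x.
by apply: le_trans (hf x) _; rewrite !patch_setT.
Qed.

Section bhg.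
Context (R : realType) (m : nat).
Implicit Types (alpha : R) (p : 'I_m -> R).

Lemma size_pvalue_order p : size (pvalue_order p) = m.
Proof. by rewrite size_sort size_enum_ord. Qed.

Lemma pvalue_order_uniq p : uniq (pvalue_order p).
Proof. by rewrite sort_uniq enum_uniq. Qed.

Lemma ordered_pvalues_sorted p : sorted <=%R (ordered_pvalues p).
Proof. by rewrite sorted_map; apply: sort_sorted => i k; exact: le_total. Qed.

Lemma bhg_count_le alpha p : (bhg_count alpha p <= m)%N.
Proof. by apply/bigmax_leqP => j _; exact: ltn_ord. Qed.

(** A positive maximum is over a nonempty set of indices, hence attained. The [.-1] appears because
    order statistics are numbered from 0. *)
Lemma bhg_count_gt0 alpha p : (0 < bhg_count alpha p)%N ->
  (ordered_pvalues p)`_(bhg_count alpha p).-1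
    <= bhg_threshold m alpha (bhg_count alpha p).
Proof.
rewrite /bhg_count.
have [j0 Qj0 _|Q0] := pickP (fun j : 'I_m =>
  (ordered_pvalues p)`_j <= bhg_threshold m alpha j.+1); last first.
  by rewrite big_pred0.
by rewrite (bigop.bigmax_eq_arg _ Qj0); case: arg_maxnP.
Qed.

Lemma card_bhg_rejected alpha p :
  #|bhg_rejected alpha p| = bhg_count alpha p.
Proof.
rewrite cardsE (card_uniqP _) ?take_uniq ?pvalue_order_uniq//.
by rewrite size_takel// size_pvalue_order bhg_count_le.
Qed.

(** A rejected [i] sits before position [bhg_count alpha p] in the sorted list, so [p i] is at most
    the last rejected order statistic, which meets its threshold. *)
Lemma bhg_rejected_le alpha p (i : 'I_m) : i \in bhg_rejected alpha p ->
  p i <= bhg_threshold m alpha #|bhg_rejected alpha p|.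
Proof.
rewrite card_bhg_rejected inE => /index_ltn ltic.
have c0 := leq_ltn_trans (leq0n _) ltic.
apply: le_trans (bhg_count_gt0 c0).
have iin : i \in pvalue_order p by rewrite mem_sort mem_enum.
have szo : size (ordered_pvalues p) = m by rewrite size_map size_pvalue_order.
have -> : p i = (ordered_pvalues p)`_(index i (pvalue_order p)).
  by rewrite (nth_map i) ?index_mem// nth_index.
apply: (sorted_leq_nth le_trans lexx) (ordered_pvalues_sorted p) _ _ _ _ _.
- by rewrite inE szo (leq_trans ltic)// bhg_count_le.
- by rewrite inE szo prednK// bhg_count_le.
- by rewrite -ltnS prednK.
Qed.

End bhg.

Section weights.
Context (R : realType).

(* Indices start at 0: [bhg_weight m j] is the weight of the threshold for
   [j + 1] rejections. *)
Definition truncated_inv (m j : nat) : R := if (j < m)%N then j.+1%:R^-1 else 0.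

(** Since [truncated_inv m m = 0], the last weight is [1 / m] and the telescoping leaves no boundary
    term. *)
Definition bhg_weight (m j : nat) : R :=
  truncated_inv m j - truncated_inv m j.+1.

Lemma bhg_weight_ge0 m j : 0 <= bhg_weight m j.
Proof.
rewrite /bhg_weight /truncated_inv; have [jm|mj] := ltnP j m; last first.
  by rewrite ltnNge (leq_trans mj)// subrr.
case: ifP => _; last by rewrite subr0 invr_ge0.
by rewrite subr_ge0 lef_pV2 ?posrE ?ltr0n// ler_nat.
Qed.

Lemma sum_bhg_weight m k : (k < m)%N ->
  \sum_(k <= j < m) bhg_weight m j = k.+1%:R^-1.
Proof.
move=> km; rewrite (@telescope_sumr_eq _ k m (fun j => - truncated_inv m j)).
- by rewrite /truncated_inv ltnn km oppr0 sub0r opprK.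
- exact: ltnW.
- by move=> j _; rewrite opprK addrC.
Qed.

Lemma sum_nat_bhg_weight m :
  \sum_(j < m) bhg_weight m j * j.+1%:R = \sum_(1 <= r < m.+1) r%:R^-1.
Proof.
(* Abel summation for any sequence; the term [v n * n%:R] vanishes for [v = truncated_inv m] at
   [n = m]. *)
have abel (v : nat -> R) n :
    \sum_(j < n) (v j - v j.+1) * j.+1%:R = \sum_(j < n) v j - v n * n%:R.
  elim: n => [|n IH]; first by rewrite !big_ord0 mulr0 subr0.
  by rewrite !big_ord_recr/= IH -natr1; ring.
rewrite abel {2}/truncated_inv ltnn mul0r subr0 big_add1 big_mkord.
by apply: eq_bigr => j _; rewrite /truncated_inv ltn_ord.
Qed.

Lemma fdp_le_weighted_sum (m : nat) (alpha : R) (p : 'I_m -> R)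
    (nulls : {set 'I_m}) : 0 <= alpha ->
  false_discovery_proportion R nulls (bhg_rejected alpha p) <=
  \sum_(i in nulls) \sum_(j < m)
    bhg_weight m j * (p i <= bhg_threshold m alpha j.+1)%R%:R.
Proof.
move=> a0; rewrite /false_discovery_proportion.
set S := bhg_rejected alpha p.
have -> : #|(nulls :&: S)%SET|%:R = \sum_(i in nulls) (i \in S)%:R :> R.
  rewrite -sum1_card natr_sum (eq_bigl _ _ (fun i => finset.in_setI i _ _)) big_mkcondr/=.
  by apply: eq_bigr => i _; case: (i \in S).
rewrite mulr_suml; apply: ler_sum => i _.
have [iS|_] := boolP (i \in S); last first.
  by rewrite mul0r sumr_ge0// => j _; rewrite mulr_ge0// bhg_weight_ge0.
have S0 : (0 < #|S|)%N by apply/card_gt0P; exists i.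
have Sm : (#|S| <= m)%N by rewrite card_bhg_rejected bhg_count_le.
(* Expand [1 / #|S|] as the tail of weights from index [#|S|.-1]; on the right, the terms before
   that index are nonnegative and are dropped. *)
rewrite (maxn_idPl S0) mul1r -(prednK S0) -(@sum_bhg_weight m) ?prednK//.
rewrite -(big_mkord predT (fun j => bhg_weight m j *
  (p i <= bhg_threshold m alpha j.+1)%R%:R)) [leRHS](@big_cat_nat _ _ _ #|S|.-1)//=; last first.
  by rewrite (leq_trans (leq_pred _)).
rewrite ler_wpDl ?sumr_ge0//.
  by move=> j _; rewrite mulr_ge0// bhg_weight_ge0.
rewrite !big_nat; apply: ler_sum => j /andP[Sj _].
(* On the tail every indicator is 1, because thresholds increase with [j]. *)
suff -> : p i <= bhg_threshold m alpha j.+1 by rewrite mulr1.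
apply: le_trans (bhg_rejected_le iS) _; rewrite -/S.
apply: ler_wpM2r; last by rewrite ler_wpM2l// ler_nat -(prednK S0) ltnS.
by rewrite invr_ge0 mulr_ge0// sumr_ge0// => r _; rewrite invr_ge0.
Qed.

End weights.

Section stopped.
Context (R : realType) (m : nat) (d dE : measure_display)
  (Omega : measurableType d) (E : 'I_m -> measurableType dE)
  (X : forall i : 'I_m, nat -> {mfun Omega >-> E i}).

Lemma data_filtration_measurable n : data_filtration X n `<=` measurable.
Proof.
apply: smallest_sub; first exact: sigma_algebra_measurable.
move=> _ [i _ [k _ [B mB <-]]].
exact: (measurable_funPT (X i k)) measurableT _ mB.
Qed.

(** [T] has countably many finite values, so the event is the union over [n] of [T = n] intersected
    with [q n <= s]. This lets its indicator be integrated. *)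
Lemma stopped_sublevel_measurable (q : nat -> Omega -> R)
    (T : Omega -> option nat) (s : R) :
  adapted (data_filtration X) q -> stopping_time (data_filtration X) T ->
  measurable [set w | exists2 n, T w = Some n & q n w <= s].
Proof.
move=> qa hT.
have mT n : measurable [set w | exists2 k : nat, T w = Some k & (k <= n)%N].
  exact: data_filtration_measurable (hT n).
have mTn n : measurable [set w | T w = Some n].
  case: n => [|n].
    suff -> : [set w | T w = Some 0%N] =
        [set w | exists2 k : nat, T w = Some k & (k <= 0)%N] by [].
    apply/seteqP; split => w /=; first by exists 0%N.
    by move=> [k ->]; rewrite leqn0 => /eqP ->.
  suff -> : [set w | T w = Some n.+1] =
      [set w | exists2 k : nat, T w = Some k & (k <= n.+1)%N] `\`
      [set w | exists2 k : nat, T w = Some k & (k <= n)%N].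
    exact: measurableD.
  apply/seteqP; split => w /=.
    move=> ->; split; first by exists n.+1.
    by move=> [k [<-]]; rewrite ltnn.
  move=> [[k -> kn] nk]; congr Some; apply/eqP; rewrite eqn_leq kn ltnNge.
  by apply/negP => kn'; apply: nk; exists k.
rewrite (_ : [set w | _] =
    \bigcup_n ([set w | T w = Some n] `&` (q n @^-1` `]-oo, s]))).
  apply: bigcup_measurable => n _; apply: measurableI => //.
  apply: (@data_filtration_measurable n); apply: qa.
  by exists `]-oo, s]%classic => //; rewrite setTI.
apply/seteqP; split => w /=.
  by move=> [n Tn qs]; exists n => //; split => //=; rewrite in_itv.
by move=> [n _ [/= Tn]]; rewrite in_itv/= => qs; exists n.
Qed.

End stopped.

Theorem proposition8 (R : realType) (m : nat)
    (d dE : measure_display) (Omega : measurableType d)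
    (E : 'I_m -> measurableType dE)
    (X : forall i : 'I_m, nat -> {mfun Omega >-> E i})
    (Theta : 'I_m -> Type) (theta0 : forall i : 'I_m, Theta i)
    (P : (forall i : 'I_m, Theta i) -> probability Omega R)
    (p : 'I_m -> nat -> Omega -> R)
    (hp : forall i : 'I_m,
      always_valid P (data_filtration X)
        [set theta | theta i = theta0 i] (p i))
    (alpha : R) (halpha : 0 < alpha < 1)
    (T : Omega -> option nat)
    (hT : stopping_time (data_filtration X) T)
    (theta : forall i : 'I_m, Theta i) :
  ('E_(P theta) [fun w => false_discovery_proportion R
      (true_nulls theta0 theta) (bhg_rejected_at alpha p T w)]
    <= alpha%:E)%E.
Proof.
have /andP[a0 a1] := halpha.
pose H : R := \sum_(1 <= r < m.+1) r%:R^-1.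
pose A i (j : nat) := [set w | exists2 n, T w = Some n &
  p i n w <= bhg_threshold m alpha j].
have mA i j : measurable (A i j).
  by have [_ pa _] := hp i; exact: stopped_sublevel_measurable.
(* Always-validity needs a level in [[0, 1]]: for [j <= m] the threshold is at most [alpha / H], and
   [H >= 1] by its first term. *)
have PA i j : i \in true_nulls theta0 theta -> (j <= m)%N ->
    (P theta (A i j) <= (bhg_threshold m alpha j)%:E)%E.
  rewrite inE => /asboolP i0 jm; have [_ _ pv] := hp i; apply: pv => //.
  have H1 : 1 <= H.
    rewrite /H big_nat_recl; last exact: leq_ltn_trans (leq0n i) (ltn_ord i).
    by rewrite invr1 lerDl sumr_ge0.
  have m0 : (0 < m)%N by exact: leq_ltn_trans (leq0n i) (ltn_ord i).
  have H0 : 0 < m%:R * H by rewrite mulr_gt0 ?ltr0n// (lt_le_trans ltr01).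
  rewrite /bhg_threshold -/H; apply/andP; split.
    by rewrite divr_ge0 ?(ltW H0)// mulr_ge0// ltW.
  rewrite ler_pdivrMr// mul1r (@le_trans _ _ (1 * m%:R))//.
    by rewrite ler_pM ?(ltW a0) ?(ltW a1)// ler_nat.
  by rewrite mul1r ler_peMr.
rewrite unlock.
apply: (@le_trans _ _ (\int[P theta]_w (\sum_(i in true_nulls theta0 theta)
    \sum_(j < m) (bhg_weight R m j)%:E * (\1_(A i j.+1) w)%:E))%E).
  apply: ge0_le_integralT => w; first by rewrite lee_fin divr_ge0.
  rewrite (_ : (\sum_(i in _) _)%E = (\sum_(i in true_nulls theta0 theta)
    \sum_(j < m) bhg_weight R m j * \1_(A i j.+1) w)%:E); last first.
    rewrite -sumEFin; apply: eq_bigr => i _; rewrite -sumEFin.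
    by apply: eq_bigr => j _; rewrite EFinM.
  rewrite lee_fin /= /bhg_rejected_at; case Tw : (T w) => [n|].
    apply: le_trans (fdp_le_weighted_sum _ _ (ltW a0)) _.
    apply: ler_sum => i _; apply: ler_sum => j _.
    rewrite ler_wpM2l ?bhg_weight_ge0// indicE ler_nat.
    by case: leP => // pij; rewrite mem_set//; exists n.
  (* If [T] is infinite, nothing is rejected and the proportion is 0. *)
  rewrite /false_discovery_proportion finset.setI0 cards0 mul0r.
  apply: sumr_ge0 => i _; apply: sumr_ge0 => j _.
  by rewrite mulr_ge0 ?bhg_weight_ge0.
have w0 j : (0 <= (bhg_weight R m j)%:E)%E by rewrite lee_fin bhg_weight_ge0.
pose f i (j : 'I_m) w : \bar R :=
  ((bhg_weight R m j)%:E * (\1_(A i j.+1) w)%:E)%E.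
have mf i j : measurable_fun [set: Omega] (f i j).
  by apply/measurable_EFinP; apply: measurable_funM => //;
    exact: measurable_indic.
(* A sum over a filtered list has no side condition, the form that [ge0_integral_sum] exchanges with
   the integral. *)
under eq_integral do rewrite -big_filter.
rewrite ge0_integral_sum//; last 2 first.
- by move=> i; apply: emeasurable_sum => j; exact: mf.
- by move=> i w _; apply: sume_ge0 => j _; rewrite mule_ge0// lee_fin.
rewrite big_filter.
(* There are at most [m] true nulls, so [alpha / m] for each suffices; if [m = 0], division by zero
   gives 0. *)
apply: (@le_trans _ _ (\sum_(i in true_nulls theta0 theta)
    (alpha / m%:R)%:E)%E); last first.
  rewrite sumEFin lee_fin sumr_const -[X in X <= _]mulr_natr.
  have [m0|m0] := posnP m.
    by rewrite (_ : m%:R = 0 :> R) ?m0// invr0 mulr0 mul0r ltW.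
  rewrite mulrAC ler_pdivrMr ?ltr0n// ler_wpM2l ?(ltW a0)// ler_nat.
  by rewrite (leq_trans (max_card _))// card_ord.
apply: lee_sum => i i0.
rewrite ge0_integral_sum//; last 2 first.
- by move=> j; exact: mf.
- by move=> j w _; rewrite mule_ge0// lee_fin.
apply: (@le_trans _ _ (\sum_(j < m) (bhg_weight R m j *
    bhg_threshold m alpha j.+1)%:E)%E).
  apply: lee_sum => j _; rewrite ge0_integralZl_EFin ?bhg_weight_ge0//.
  - by rewrite integral_indic// setIT EFinM lee_wpmul2l// PA.
  - by apply/measurable_EFinP; exact: measurable_indic.
have m0 : (0 < m)%N by exact: leq_ltn_trans (leq0n i) (ltn_ord i).
have H0 : H != 0.
  rewrite /H big_nat_recl// invr1 gt_eqF// ltr_pwDl// sumr_ge0//.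
rewrite sumEFin lee_fin /bhg_threshold -/H.
(* Pull out [alpha / (m H)]; the remaining weighted sum is [H], which cancels. *)
under eq_bigr do rewrite mulrA mulrCA -mulrA.
rewrite -mulr_sumr -mulr_suml sum_nat_bhg_weight -/H.
by rewrite invfM [H * _]mulrCA mulfV// mulr1.
Qed.
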